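(* Let $G$ be a profinite group, $A$ a finite simple $G$-module, $F=\operatorname{End}_G(A)$, and $n\in\mathbb{N}$. The categories $\mathcal{T}^n$ and $\mathcal{H}^n$ are dually equivalent via the functors $X^n\colon\mathcal{H}^n\to\mathcal{T}^n$ and $Y^n\colon\mathcal{T}^n\to\mathcal{H}^n$; that is, $X^n$ and $Y^n$ are mutually quasi-inverse (the word ''dually'' refers to the fact that the linear map underlying the image of a $G$-homomorphism goes in the opposite direction, and conversely).
   Context: $H^n(G,K)$ denotes the continuous cochain cohomology of $G$ with coefficients in a profinite $G$-module $K$, computed by continuous non-homogeneous cochains $G^n\to K$, with $n$-cocycles $\bar Z^n(G,K)$. The ring $F=\operatorname{End}_G(A)$ is a finite field, and $A$ and $H^n(G,A)$ are vector spaces over $F$ via $\alpha f=\alpha\circ f$. For a profinite $G$-module $K$, $K^*=\operatorname{Hom}_G(K,A)$ is the $F$-vector space of continuous $G$-homomorphisms $K\to A$; $K$ is $A$-generated if $\bigcap_{\phi\in K^*}\operatorname{Ker}\phi=0$. For an $F$-vector space $V$, $V^*$ is the profinite ($A$-generated) $G$-module of $F$-linear maps $V\to A$, with topology induced from the product $A^V$ and action $(g\psi)(v)=g\psi(v)$. Category $\mathcal{H}^n$: objects are pairs $(K,f)$ with $K$ an $A$-generated profinite $G$-module and $f\in H^n(G,K)$; a morphism $(K_1,f_1)\to(K_2,f_2)$ is a continuous $G$-homomorphism $\beta\colon K_1\to K_2$ with $\beta_*f_1=f_2$. Category $\mathcal{T}^n$: objects are pairs $(V,S)$ with $V$ an $F$-vector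 space and $S\colon V\to H^n(G,A)$ an $F$-linear map; a morphism $(V_1,S_1)\to(V_2,S_2)$ is an $F$-linear map $T\colon V_2\to V_1$ with $S_2=S_1\circ T$. Functor $X^n$: $X^n(K,f)=(K^*,S_{K,f})$ where $S_{K,f}(\phi)=\phi_*(f)$ for $\phi\in K^*$; for a morphism $\beta$ from $(K_1,f_1)$ to $(K_2,f_2)$, $X^n(\beta)=\beta^*\colon K_2^*\to K_1^*$, $\psi\mapsto\psi\circ\beta$. Functor $Y^n$: given $(V,S)$, lift $S$ to an $F$-linear map $S'\colon V\to\bar Z^n(G,A)$ and define $f'\in\bar Z^n(G,V^* )$ by $\big(f'(\sigma)\big)(v)=\big(S'(v)\big)(\sigma)$ for $\sigma\in G^n$, $v\in V$; its class $f\in H^n(G,V^* )$ does not depend on the lift, and $Y^n(V,S)=(V^*,f)$. For a morphism $T\colon V_2\to V_1$ from $(V_1,S_1)$ to $(V_2,S_2)$, $Y^n(T)=T^*\colon V_1^*\to V_2^*$, $\phi\mapsto\phi\circ T$. *)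

(* Defs.v *)
From HB Require Import structures.
From mathcomp Require Import all_boot all_order all_algebra.
From mathcomp Require finfield.
From mathcomp Require Import generic_quotient ring_quotient.
From mathcomp Require Import all_classical.
From mathcomp Require Import topology tvs.

Set Implicit Arguments.
Unset Strict Implicit.
Unset Printing Implicit Defensive.

Import GRing.Theory.

Local Open Scope classical_set_scope.
Local Open Scope quotient_scope.
Local Open Scope ring_scope.

HB.mixin Record isProfiniteGroup G & Topological G & Group G := {
  mulg_continuous : continuous (fun x : G * G => (x.1 * x.2)%g);
  invg_continuous : continuous (fun x : G => (x^-1)%g);
  pgroup_compact : compact [set: G];
  pgroup_hausdorff : hausdorff_space G;
  pgroup_totally_disconnected : totally_disconnected [set: G] }.

#[short(type="profiniteGroupType")]
HB.structure Definition ProfiniteGroup :=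
  {G of isProfiniteGroup G & Topological G & Group G}.

HB.mixin Record isGModule (G : profiniteGroupType) K & GRing.Zmodule K := {
  gact : G -> K -> K;
  gact1 : forall x, gact 1%g x = x;
  gactM : forall g h x, gact (g * h)%g x = gact g (gact h x);
  gactD : forall g x y, gact g (x + y) = gact g x + gact g y }.

#[short(type="gmodType")]
HB.structure Definition GModule (G : profiniteGroupType) :=
  {K of isGModule G K & GRing.Zmodule K}.

HB.mixin Record isProfiniteModule (G : profiniteGroupType) K
    & TopologicalZmodule K & GModule G K := {
  gact_continuous : continuous (fun p : G * K => gact p.1 p.2);
  pmod_compact : compact [set: K];
  pmod_hausdorff : hausdorff_space K;
  pmod_totally_disconnected : totally_disconnected [set: K] }.

#[short(type="profiniteModType")]
HB.structure Definition ProfiniteModule (G : profiniteGroupType) :=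
  {K of isProfiniteModule G K & TopologicalZmodule K & GModule G K}.

Definition gsubmodule (G : profiniteGroupType) (K : gmodType G) (B : set K) :=
  [/\ B 0, forall x y, B x -> B y -> B (x - y) & forall g x, B x -> B (gact g x)].

(* A finite Hausdorff space is discrete. *)
HB.mixin Record isFiniteSimple (G : profiniteGroupType) A
    & ProfiniteModule G A := {
  fsmod_finite : finite_set [set: A];
  fsmod_nonzero : [set: A] <> [set 0];
  fsmod_simple :
    forall B : set A, gsubmodule B -> B = [set 0] \/ B = [set: A] }.

#[short(type="finSimpleModType")]
HB.structure Definition FinSimpleModule (G : profiniteGroupType) :=
  {A of isFiniteSimple G A & ProfiniteModule G A}.

Section GModuleTheory.
Variables (G : profiniteGroupType) (K : gmodType G).

Lemma gact_zmod_morphism (g : G) : zmod_morphism (gact g : K -> K).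
Proof.
move=> x y; apply/eqP; rewrite -subr_eq0 opprB.
have H0 : gact g (0 : K) = 0.
  by apply: (@addrI _ (gact g (0 : K))); rewrite -gactD !addr0.
have HN z : gact g (- z : K) = - gact g z.
  by apply/eqP; rewrite -addr_eq0 -gactD addNr H0.
by rewrite gactD HN addrC subrKA subrr.
Qed.

HB.instance Definition _ (g : G) :=
  GRing.isZmodMorphism.Build K K (gact g) (gact_zmod_morphism g).

End GModuleTheory.

Lemma zmod_continuousB (X : topologicalType) (K : topologicalZmodType)
  (f g : X -> K) : continuous f -> continuous g -> continuous (f - g).
Proof.
move=> fc gc x; apply: (@continuous_comp _ _ _ (fun x => (f x, g x))
  (fun p : K * K => p.1 - p.2)); last exact: sub_continuous.
by apply: cvg_pair; [exact: fc | exact: gc].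
Qed.

Definition is_ghom (G : profiniteGroupType) (K1 K2 : profiniteModType G)
    (f : K1 -> K2) :=
  [/\ forall x y, f (x + y) = f x + f y,
      forall g x, f (gact g x) = gact g (f x) & continuous f].

Record ghom (G : profiniteGroupType) (K1 K2 : profiniteModType G) := GHom {
  ghom_fun :> K1 -> K2;
  ghom_subproof : `[< is_ghom ghom_fun >] }.

HB.instance Definition _ G K1 K2 := [isSub for @ghom_fun G K1 K2].
HB.instance Definition _ G K1 K2 := [Choice of @ghom G K1 K2 by <:].

Section GHom.
Variables (G : profiniteGroupType).
Implicit Types K : profiniteModType G.

Lemma ghomP K1 K2 (f : ghom K1 K2) : is_ghom f.
Proof. exact/asboolP/(ghom_subproof f). Qed.

Lemma ghom_ext K1 K2 (f g : ghom K1 K2) : f =1 g -> f = g.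
Proof. by move=> fg; apply: val_inj; apply/funext. Qed.

Lemma ghom_continuous K1 K2 (f : ghom K1 K2) : continuous f.
Proof. by case: (ghomP f). Qed.

Lemma ghom_gact K1 K2 (f : ghom K1 K2) g x : f (gact g x) = gact g (f x).
Proof. by case: (ghomP f). Qed.

Lemma ghom_zmod_morphism K1 K2 (f : ghom K1 K2) : zmod_morphism f.
Proof.
case: (ghomP f) => fD _ _ x y.
by apply/eqP; rewrite eq_sym subr_eq -fD subrK.
Qed.

HB.instance Definition _ K1 K2 (f : ghom K1 K2) :=
  GRing.isZmodMorphism.Build K1 K2 f (ghom_zmod_morphism f).

Definition is_ghom_pred K1 K2 : {pred K1 -> K2} := fun f => `[< is_ghom f >].

Lemma is_ghom_zmod_closed K1 K2 : zmod_closed (@is_ghom_pred K1 K2).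
Proof.
split=> [|f g /asboolP[fD fG fc] /asboolP[gD gG gc]]; apply/asboolP; split.
- by move=> x y; rewrite addr0.
- by move=> g x; rewrite raddf0.
- by move=> x; apply: cvg_cst.
- by move=> x y; rewrite !fctE fD gD opprD addrACA.
- by move=> h x; rewrite !fctE fG gG raddfB.
- exact: zmod_continuousB.
Qed.

HB.instance Definition _ K1 K2 :=
  GRing.isZmodClosed.Build (K1 -> K2) (@is_ghom_pred K1 K2)
    (@is_ghom_zmod_closed K1 K2).
HB.instance Definition _ K1 K2 :=
  GRing.SubChoice_isSubZmodule.Build (K1 -> K2) (@is_ghom_pred K1 K2)
    (ghom K1 K2) (@is_ghom_zmod_closed K1 K2).

Lemma ghom_id_subproof K : `[< is_ghom (@idfun K) >].
Proof. by apply/asboolP; split=> // x; apply: cvg_id. Qed.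
Definition ghom_id K : ghom K K := GHom (ghom_id_subproof K).

Lemma ghom_comp_subproof K1 K2 K3 (f : ghom K2 K3) (g : ghom K1 K2) :
  `[< is_ghom (f \o g) >].
Proof.
apply/asboolP; split=> [x y|h x|x] /=; first by rewrite !raddfD.
  by rewrite !ghom_gact.
by apply: continuous_comp; apply: ghom_continuous.
Qed.
Definition ghom_comp K1 K2 K3 (f : ghom K2 K3) (g : ghom K1 K2) : ghom K1 K3 :=
  GHom (ghom_comp_subproof f g).

End GHom.

(* For K finite, hence discrete, continuity is automatic and this is the usual
   ring End_G(K). *)
Definition gendo (G : profiniteGroupType) (K : profiniteModType G) : Type :=
  ghom K K.

Section Endomorphisms.
Variable G : profiniteGroupType.

Section Ring.
Variable K : profiniteModType G.
Local Notation E := (gendo K).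

HB.instance Definition _ := GRing.Zmodule.on E.

Fact gendo_mulA : associative (fun f g : E => ghom_comp f g : E).
Proof. by move=> f g h; apply: ghom_ext. Qed.
Fact gendo_mul1 : left_id (ghom_id K : E) (fun f g : E => ghom_comp f g : E).
Proof. by move=> f; apply: ghom_ext. Qed.
Fact gendo_mulr1 : right_id (ghom_id K : E) (fun f g : E => ghom_comp f g : E).
Proof. by move=> f; apply: ghom_ext. Qed.
Fact gendo_mulDl :
  left_distributive (fun f g : E => ghom_comp f g : E) +%R.
Proof. by move=> f g h; apply: ghom_ext. Qed.
Fact gendo_mulDr :
  right_distributive (fun f g : E => ghom_comp f g : E) +%R.
Proof. by move=> f g h; apply: ghom_ext => x; apply: (raddfD f). Qed.

HB.instance Definition _ := GRing.Zmodule_isPzRing.Build E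
  gendo_mulA gendo_mul1 gendo_mulr1 gendo_mulDl gendo_mulDr.

End Ring.

Section Field.
Variable A : finSimpleModType G.
Local Notation F := (gendo A).

Lemma finSimpleMod_closed (U : set A) : closed U.
Proof.
apply: compact_closed; first exact: pmod_hausdorff.
by apply: finite_compact; apply: sub_finite_set (@fsmod_finite _ A).
Qed.

Lemma finSimpleMod_open (U : set A) : open U.
Proof. by rewrite -[U]setCK openC; exact: finSimpleMod_closed. Qed.

Lemma finSimpleMod_continuous (X : topologicalType) (f : A -> X) : continuous f.
Proof. by apply/continuousP => U _; exact: finSimpleMod_open. Qed.

Lemma gendo_inj (f : F) : f != 0 -> injective f.
Proof.
move=> f0; apply: raddf_inj => x fx0.
have [|kf|kf] := @fsmod_simple _ A [set x | f x = 0].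
- split=> /= [|y z fy fz|g y fy]; first exact: raddf0.
    by rewrite raddfB /= fy fz subr0.
  by rewrite (ghom_gact (f : ghom A A)) fy raddf0.
- by have : [set x | f x = 0] x by []; rewrite kf.
- case/eqP: f0; apply: ghom_ext => y.
  by have : [set: A] y by []; rewrite -kf.
Qed.

Lemma gendo_surj (f : F) : f != 0 -> exists g : A -> A, cancel g f.
Proof.
move=> f0; suff fT y : exists x, f x = y.
  by exists (fun y => projT1 (cid (fT y))) => y; case: cid.
have [|rf|rf] := @fsmod_simple _ A (range f).
- split=> [|_ _ [u _ <-] [v _ <-]|g _ [u _ <-]]; first by exists 0; rewrite ?raddf0.
    by exists (u - v); rewrite ?raddfB.
  by exists (gact g u) => //; rewrite (ghom_gact (f : ghom A A)).
- case/eqP: f0; apply: ghom_ext => x.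
  by have : range f (f x) by []; rewrite rf.
- by have : [set: A] y by []; rewrite -rf => -[x _ <-]; exists x.
Qed.

Lemma gendo_inv_ex (f : F) : f != 0 -> exists g : F, g * f = 1 /\ f * g = 1.
Proof.
move=> f0; have [g gK] := gendo_surj f0; have fi := gendo_inj f0.
have gG : `[< is_ghom g >].
  apply/asboolP; split=> [x y|h x|]; last exact: finSimpleMod_continuous.
    by apply: fi; rewrite raddfD /= !gK.
  by apply: fi; rewrite ghom_gact !gK.
exists (GHom gG : F); split; apply: ghom_ext => x /=; last exact: gK.
by apply: fi; rewrite gK.
Qed.

Fact gendo_neq0 : (1 : F) != 0.
Proof.
apply/eqP => e; apply: (@fsmod_nonzero _ A); apply/seteqP; split=> // x _.
by have := congr1 (fun h : F => h x) e.
Qed.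
HB.instance Definition _ := GRing.PzSemiRing_isNonZero.Build F gendo_neq0.

Definition gendo_inv (f : F) : F :=
  if pselect (f != 0) is left f0 then projT1 (cid (gendo_inv_ex f0)) else f.
Definition gendo_unit : pred F := fun f => f != 0.

Fact gendo_mulVr : {in gendo_unit, left_inverse 1 gendo_inv *%R}.
Proof.
by move=> f f0; rewrite /gendo_inv; case: pselect => // f0'; case: cid => g [].
Qed.
Fact gendo_mulrV : {in gendo_unit, right_inverse 1 gendo_inv *%R}.
Proof.
by move=> f f0; rewrite /gendo_inv; case: pselect => // f0'; case: cid => g [].
Qed.
Fact gendo_unitP (x y : F) : y * x = 1 /\ x * y = 1 -> gendo_unit x.
Proof.
move=> [_ xy]; apply/eqP => x0; case/eqP: gendo_neq0.
by rewrite -xy x0 mul0r.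
Qed.
Fact gendo_inv_out : {in [predC gendo_unit], gendo_inv =1 id}.
Proof.
by move=> f /negP f0; rewrite /gendo_inv; case: pselect => // /f0.
Qed.
HB.instance Definition _ := GRing.NzRing_hasMulInverse.Build F
  gendo_mulVr gendo_mulrV gendo_unitP gendo_inv_out.

Fact finSimpleMod_enum : exists s : seq A, forall x, x \in s.
Proof.
have /finite_seqP[s sE] := @fsmod_finite _ A.
by exists s => x; have : [set: A] x by []; rewrite sE.
Qed.

Fact gendo_enum : exists s : seq F, forall f, f \in s.
Proof.
have [sA sAP] := finSimpleMod_enum.
have ltsA (f : F) (i : 'I_(size sA)) : (index (f (nth 0%R sA i)) sA < size sA)%N.
  by rewrite index_mem.
pose code (f : F) := [ffun i => Ordinal (ltsA f i)].
have code_inj : injective code.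
  move=> f g fg; apply: ghom_ext => x.
  have xs := sAP x; rewrite -index_mem in xs.
  have /(congr1 val) /= := congr1 (fun h : {ffun _} => h (Ordinal xs)) fg.
  by rewrite !ffunE /= nth_index // => /(congr1 (nth 0 sA)); rewrite !nth_index.
pose decode t : option F :=
  if pselect (exists f, code f = t) is left e then Some (projT1 (cid e)) else None.
exists (pmap decode (enum {ffun 'I_(size sA) -> 'I_(size sA)})) => f.
rewrite mem_pmap; apply/mapP; exists (code f); first by rewrite mem_enum.
rewrite /decode; case: pselect => [e|[]]; last by exists f.
by case: cid => g /= /code_inj ->.
Qed.

Let gendo_list : seq F := undup (projT1 (cid gendo_enum)).
Fact gendo_listP f : f \in gendo_list.
Proof. by rewrite mem_undup; case: cid. Qed.
Fact gendo_pickleK :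
  pcancel (index^~ gendo_list) (fun n => nth None (map some gendo_list) n).
Proof.
by move=> f; rewrite (nth_map 0) ?nth_index ?index_mem ?gendo_listP.
Qed.
HB.instance Definition _ := isCountable.Build F gendo_pickleK.
HB.instance Definition _ := isFinite.Build F
  (Finite.uniq_enumP (undup_uniq _) gendo_listP).

Fact gendo_domain : GRing.integral_domain_axiom F.
Proof.
move=> f g fg0; have [//|f0 /=] := eqVneq f 0.
by rewrite -[g]mul1r -(gendo_mulVr f0) -mulrA fg0 mulr0.
Qed.
Fact gendo_mulC : @commutative F F *%R.
Proof. exact: (@finfield.finDomain_mulrC F gendo_domain). Qed.
HB.instance Definition _ := GRing.PzRing_hasCommutativeMul.Build F gendo_mulC.
HB.instance Definition _ :=
  GRing.ComUnitRing_isIntegral.Build F gendo_domain.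
Fact gendo_field : GRing.field_axiom F. Proof. by []. Qed.
HB.instance Definition _ := GRing.UnitRing_isField.Build F gendo_field.

End Field.

Section HomScale.
Variables (A : finSimpleModType G) (K : profiniteModType G).
Local Notation F := (gendo A).
Let scale (a : F) (f : ghom K A) : ghom K A := ghom_comp a f.

Fact ghom_scaleA a b f : scale a (scale b f) = scale (a * b) f.
Proof. exact: ghom_ext. Qed.
Fact ghom_scale1 : left_id 1 scale.
Proof. by move=> f; exact: ghom_ext. Qed.
Fact ghom_scaleDr : right_distributive scale +%R.
Proof. by move=> a f g; apply: ghom_ext => x; apply: (raddfD a). Qed.
Fact ghom_scaleDl f : {morph scale^~ f : a b / a + b}.
Proof. by move=> a b; apply: ghom_ext. Qed.

HB.instance Definition _ := GRing.Zmodule_isLmodule.Build F (ghom K A)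
  ghom_scaleA ghom_scale1 ghom_scaleDr ghom_scaleDl.
End HomScale.

End Endomorphisms.

Section Differential.
Variables (G : profiniteGroupType) (K : profiniteModType G) (n : nat).

(* (g_0, .., g_n) |-> (g_0, .., g_i * g_(i+1), .., g_n) *)
Definition face (i : 'I_n) (s : {ptws 'I_n.+1 -> G}) : {ptws 'I_n -> G} :=
  fun j => if (j < i)%N then s (widen_ord (leqnSn n) j)
           else if j == i then (s (widen_ord (leqnSn n) j) * s (lift ord0 j))%g
           else s (lift ord0 j).

Definition face_first (s : {ptws 'I_n.+1 -> G}) : {ptws 'I_n -> G} :=
  fun j => s (lift ord0 j).

Definition face_last (s : {ptws 'I_n.+1 -> G}) : {ptws 'I_n -> G} :=
  fun j => s (widen_ord (leqnSn n) j).

Definition diff (c : {ptws 'I_n -> G} -> K) : {ptws 'I_n.+1 -> G} -> K :=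
  fun s => gact (s ord0) (c (face_first s))
           + \sum_(i < n) c (face i s) *~ (-1) ^+ i.+1
           + c (face_last s) *~ (-1) ^+ n.+1.

Lemma diff_zmod_morphism : zmod_morphism diff.
Proof.
have abc (x y z x' y' z' : K) :
    (x - x') + (y - y') + (z - z') = x + y + z - (x' + y' + z').
  by rewrite (addrACA x) (addrACA (x + y)) !opprD.
move=> c d; apply/funext => s; rewrite /diff !fctE raddfB.
under eq_bigr do rewrite mulrzBl.
by rewrite sumrB mulrzBl abc.
Qed.
HB.instance Definition _ :=
  GRing.isZmodMorphism.Build _ _ diff diff_zmod_morphism.
End Differential.

Lemma diff_ghom (G : profiniteGroupType) (K1 K2 : profiniteModType G)
    (b : ghom K1 K2) n (c : {ptws 'I_n -> G} -> K1) :
  diff (b \o c) = b \o diff c.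
Proof.
apply/funext => s; rewrite /diff /= !raddfD /= ghom_gact raddf_sum raddfMz.
by congr (_ + _ + _); apply: eq_bigr => i _; rewrite raddfMz.
Qed.

Record cochain (G : profiniteGroupType) (n : nat) (K : profiniteModType G) :=
  Cochain {
    cochain_fun :> {ptws 'I_n -> G} -> K;
    cochain_subproof : `[< continuous cochain_fun >] }.

HB.instance Definition _ G n K := [isSub for @cochain_fun G n K].
HB.instance Definition _ G n K := [Choice of @cochain G n K by <:].

Section Cochains.
Variables (G : profiniteGroupType) (n : nat).
Implicit Types K : profiniteModType G.

Lemma cochain_continuous K (c : cochain n K) : continuous c.
Proof. exact/asboolP/(cochain_subproof c). Qed.

Lemma cochain_ext K (c d : cochain n K) : c =1 d -> c = d.
Proof. by move=> cd; apply: val_inj; apply/funext. Qed.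

Definition continuous_pred K : {pred {ptws 'I_n -> G} -> K} :=
  fun c => `[< continuous c >].
Fact continuous_zmod_closed K : zmod_closed (@continuous_pred K).
Proof.
split=> [|c d /asboolP cc /asboolP dc]; apply/asboolP.
  exact: cst_continuous.
exact: zmod_continuousB.
Qed.
HB.instance Definition _ K :=
  GRing.isZmodClosed.Build ({ptws 'I_n -> G} -> K) (@continuous_pred K)
    (@continuous_zmod_closed K).
HB.instance Definition _ K :=
  GRing.SubChoice_isSubZmodule.Build ({ptws 'I_n -> G} -> K)
    (@continuous_pred K) (cochain n K) (@continuous_zmod_closed K).

Fact cochain_map_subproof K1 K2 (b : ghom K1 K2) (c : cochain n K1) :
  `[< continuous (b \o c) >].
Proof.
apply/asboolP => x; apply: continuous_comp; first exact: cochain_continuous.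
exact: ghom_continuous.
Qed.
Definition cochain_map K1 K2 (b : ghom K1 K2) (c : cochain n K1) :
  cochain n K2 := Cochain (cochain_map_subproof b c).
End Cochains.

Record cocycle (G : profiniteGroupType) (n : nat) (K : profiniteModType G) :=
  Cocycle {
    cocycle_cochain :> cochain n K;
    cocycle_subproof : `[< diff cocycle_cochain = 0 >] }.

HB.instance Definition _ G n K := [isSub for @cocycle_cochain G n K].
HB.instance Definition _ G n K := [Choice of @cocycle G n K by <:].

Section Cocycles.
Variables (G : profiniteGroupType) (n : nat).
Implicit Types K : profiniteModType G.

Lemma cocycleP K (z : cocycle n K) : diff z = 0.
Proof. exact/asboolP/(cocycle_subproof z). Qed.

Lemma cocycle_ext K (c d : cocycle n K) : c =1 d -> c = d.
Proof. by move=> cd; apply: val_inj; apply: cochain_ext. Qed.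

Definition cocycle_pred K : {pred cochain n K} := fun c => `[< diff c = 0 >].
Fact cocycle_zmod_closed K : zmod_closed (@cocycle_pred K).
Proof.
split=> [|c d /asboolP c0 /asboolP d0]; apply/asboolP; first exact: raddf0.
by rewrite [LHS](raddfB (@diff G K n)) /= c0 d0 subr0.
Qed.
HB.instance Definition _ K :=
  GRing.isZmodClosed.Build (cochain n K) (@cocycle_pred K)
    (@cocycle_zmod_closed K).
HB.instance Definition _ K :=
  GRing.SubChoice_isSubZmodule.Build (cochain n K)
    (@cocycle_pred K) (cocycle n K) (@cocycle_zmod_closed K).

Fact cocycle_map_subproof K1 K2 (b : ghom K1 K2) (z : cocycle n K1) :
  `[< diff (cochain_map b z) = 0 >].
Proof.
apply/asboolP; rewrite diff_ghom cocycleP.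
by apply/funext => s /=; rewrite raddf0.
Qed.
Definition cocycle_map K1 K2 (b : ghom K1 K2) (z : cocycle n K1) :
  cocycle n K2 := Cocycle (cocycle_map_subproof b z).
End Cocycles.

(* Only used on cocycles; there are no 0-coboundaries other than 0. *)
Definition is_coboundary (G : profiniteGroupType) (n : nat)
    (K : profiniteModType G) : ({ptws 'I_n -> G} -> K) -> Prop :=
  match n with
  | 0 => fun c => c = 0
  | m.+1 => fun c => exists b : cochain m K, c = diff b
  end.

Section Cohomology.
Variables (G : profiniteGroupType) (n : nat).
Implicit Types K : profiniteModType G.

Definition coboundary K : {pred cocycle n K} := fun z => `[< is_coboundary z >].

Fact coboundary_zmod_closed K : zmod_closed (@coboundary K).
Proof.
rewrite /coboundary; split=> [|z w /asboolP zB /asboolP wB]; apply/asboolP.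
  by case: (n) => [//|m]; exists 0; rewrite [RHS]raddf0.
have -> : (z - w : cocycle n K) = (z : _ -> K) - (w : _ -> K) :> (_ -> K) by [].
move: (z : _ -> K) (w : _ -> K) zB wB.
case: (n) => [|m] c d /=; first by move=> -> ->; rewrite subr0.
by move=> [b ->] [b' ->]; exists (b - b'); rewrite -raddfB.
Qed.
HB.instance Definition _ K :=
  GRing.isZmodClosed.Build (cocycle n K) (@coboundary K)
    (@coboundary_zmod_closed K).

Definition coh K : Type := Quotient.quot (@coboundary K).
HB.instance Definition _ K := GRing.Zmodule.on (coh K).

Definition coh_class K (z : cocycle n K) : coh K :=
  \pi_(Quotient.quot (@coboundary K)) z.

Definition coh_map K1 K2 (b : ghom K1 K2) (f : coh K1) : coh K2 :=
  coh_class (cocycle_map b (repr (f : Quotient.quot (@coboundary K1)))).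

Lemma coh_class_zmod_morphism K : zmod_morphism (@coh_class K).
Proof. by move=> z w; rewrite /coh_class raddfB. Qed.
HB.instance Definition _ K :=
  GRing.isZmodMorphism.Build _ _ (@coh_class K) (@coh_class_zmod_morphism K).

Lemma coh_class_eq K (z w : cocycle n K) :
  coh_class z = coh_class w <-> is_coboundary (z - w : cocycle n K).
Proof.
rewrite /coh_class; split => [/eqP|].
  by rewrite -Quotient.idealrBE => /asboolP.
by move=> zw; apply/eqP; rewrite -Quotient.idealrBE; apply/asboolP.
Qed.

Lemma coh_surj K (f : coh K) : exists z, coh_class z = f.
Proof.
by exists (repr (f : Quotient.quot (@coboundary K))); rewrite /coh_class reprK.
Qed.

Lemma coh_mapE K1 K2 (b : ghom K1 K2) (z : cocycle n K1) :
  coh_map b (coh_class z) = coh_class (cocycle_map b z).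
Proof.
apply/coh_class_eq; set w := repr _.
have : is_coboundary (w - z : cocycle n K1).
  by apply/coh_class_eq; rewrite /coh_class reprK.
have -> : (cocycle_map b w - cocycle_map b z : cocycle n K2) =
   b \o (w - z : cocycle n K1) :> (_ -> K2).
  by apply/funext => s /=; rewrite raddfB.
move: ((w - z : cocycle n K1) : _ -> K1).
case: (n) => [|m] c /=.
  by move=> ->; apply/funext => s /=; rewrite raddf0.
by move=> [d ->]; exists (cochain_map b d); rewrite diff_ghom.
Qed.

Lemma coh_map_zmod_morphism K1 K2 (b : ghom K1 K2) : zmod_morphism (coh_map b).
Proof.
move=> f g; have [z <-] := coh_surj f; have [w <-] := coh_surj g.
rewrite -raddfB !coh_mapE -raddfB; congr coh_class.
by apply: cocycle_ext => s /=; rewrite raddfB.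
Qed.
HB.instance Definition _ K1 K2 (b : ghom K1 K2) :=
  GRing.isZmodMorphism.Build (coh K1) (coh K2) (coh_map b)
    (coh_map_zmod_morphism b).

Lemma coh_map_id K (f : coh K) : coh_map (ghom_id K) f = f.
Proof.
have [z <-] := coh_surj f; rewrite coh_mapE; congr coh_class.
exact: cocycle_ext.
Qed.

Lemma coh_map_comp K1 K2 K3 (b : ghom K2 K3) (c : ghom K1 K2) (f : coh K1) :
  coh_map (ghom_comp b c) f = coh_map b (coh_map c f).
Proof.
have [z <-] := coh_surj f; rewrite !coh_mapE; congr coh_class.
exact: cocycle_ext.
Qed.

Lemma coh_mapDl K1 K2 (b c : ghom K1 K2) (f : coh K1) :
  coh_map (b + c) f = coh_map b f + coh_map c f.
Proof.
have [z <-] := coh_surj f; rewrite !coh_mapE -raddfD; congr coh_class.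
exact: cocycle_ext.
Qed.
End Cohomology.

Section CohScale.
Variables (G : profiniteGroupType) (n : nat) (A : finSimpleModType G).
Local Notation F := (gendo A).

Fact cochain_scaleA (a b : F) (c : cochain n A) :
  cochain_map a (cochain_map b c) = cochain_map (a * b) c.
Proof. exact: cochain_ext. Qed.
Fact cochain_scale1 : left_id (1 : F) (@cochain_map G n A A).
Proof. by move=> c; exact: cochain_ext. Qed.
Fact cochain_scaleDr :
  right_distributive (fun a : F => @cochain_map G n A A a) +%R.
Proof. by move=> a c d; apply: cochain_ext => s; apply: (raddfD a). Qed.
Fact cochain_scaleDl c :
  {morph (fun a : F => @cochain_map G n A A a c) : a b / a + b}.
Proof. by move=> a b; exact: cochain_ext. Qed.
HB.instance Definition _ := GRing.Zmodule_isLmodule.Build F (cochain n A)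
  cochain_scaleA cochain_scale1 cochain_scaleDr cochain_scaleDl.

Fact cocycle_scaleA (a b : F) (c : cocycle n A) :
  cocycle_map a (cocycle_map b c) = cocycle_map (a * b) c.
Proof. exact: cocycle_ext. Qed.
Fact cocycle_scale1 : left_id (1 : F) (@cocycle_map G n A A).
Proof. by move=> c; exact: cocycle_ext. Qed.
Fact cocycle_scaleDr :
  right_distributive (fun a : F => @cocycle_map G n A A a) +%R.
Proof. by move=> a c d; apply: cocycle_ext => s; apply: (raddfD a). Qed.
Fact cocycle_scaleDl c :
  {morph (fun a : F => @cocycle_map G n A A a c) : a b / a + b}.
Proof. by move=> a b; exact: cocycle_ext. Qed.
HB.instance Definition _ := GRing.Zmodule_isLmodule.Build F (cocycle n A)
  cocycle_scaleA cocycle_scale1 cocycle_scaleDr cocycle_scaleDl.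

Fact coh_scaleA (a b : F) (f : coh n A) :
  coh_map a (coh_map b f) = coh_map (a * b) f.
Proof. by rewrite -coh_map_comp. Qed.
Fact coh_scale1 : left_id (1 : F) (@coh_map G n A A).
Proof. exact: coh_map_id. Qed.
Fact coh_scaleDr : right_distributive (fun a : F => @coh_map G n A A a) +%R.
Proof. by move=> a f g; exact: raddfD. Qed.
Fact coh_scaleDl f : {morph (fun a : F => @coh_map G n A A a f) : a b / a + b}.
Proof. by move=> a b; exact: coh_mapDl. Qed.
HB.instance Definition _ := GRing.Zmodule_isLmodule.Build F (coh n A)
  coh_scaleA coh_scale1 coh_scaleDr coh_scaleDl.
End CohScale.

Section PointwiseTopology.
Variables (V : eqType) (T : topologicalType).

Lemma ptws_eval_continuous (v : V) :
  continuous (fun p : {ptws V -> T} => p v).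
Proof. exact: (@proj_continuous V (fun=> T) v). Qed.

Lemma ptws_continuous (X : topologicalType) (h : X -> {ptws V -> T}) :
  (forall v, continuous (fun x => h x v)) -> continuous h.
Proof.
move=> hc x; apply/cvg_sup => v U [_ [[W oW <-]]] /= Whx /filterS; apply.
by apply: (hc v x); exact: open_nbhs_nbhs.
Qed.
End PointwiseTopology.

(* A is a vector space over gendo A through evaluation, a . x = a x. *)
Definition is_flinear (G : profiniteGroupType) (A : finSimpleModType G)
    (V : lmodType (gendo A)) (p : V -> A) :=
  forall (a : gendo A) u v, p (a *: u + v) = a (p u) + p v.

Record vdual (G : profiniteGroupType) (A : finSimpleModType G)
    (V : lmodType (gendo A)) := VDual {
  vdual_fun :> V -> A;
  vdual_subproof : `[< is_flinear vdual_fun >] }.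

HB.instance Definition _ G A V := [isSub for @vdual_fun G A V].
HB.instance Definition _ G A V := [Choice of @vdual G A V by <:].

Section VDual.
Variables (G : profiniteGroupType) (A : finSimpleModType G).
Implicit Types V : lmodType (gendo A).

Lemma vdualP V (p : vdual V) : is_flinear p.
Proof. exact/asboolP/(vdual_subproof p). Qed.

Lemma vdual_ext V (p q : vdual V) : p =1 q -> p = q.
Proof. by move=> pq; apply: val_inj; apply/funext. Qed.

Definition is_flinear_pred V : {pred V -> A} := fun p => `[< is_flinear p >].
Fact is_flinear_zmod_closed V : zmod_closed (@is_flinear_pred V).
Proof.
split=> [|p q /asboolP pL /asboolP qL]; apply/asboolP => a u v.
  by rewrite /= raddf0 addr0.
by rewrite !fctE pL qL raddfB opprD addrACA.
Qed.
HB.instance Definition _ V :=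
  GRing.isZmodClosed.Build (V -> A) (@is_flinear_pred V)
    (@is_flinear_zmod_closed V).
HB.instance Definition _ V :=
  GRing.SubChoice_isSubZmodule.Build (V -> A) (@is_flinear_pred V)
    (vdual V) (@is_flinear_zmod_closed V).

HB.instance Definition _ V := Topological.copy (vdual V)
  (initial_topology (@vdual_fun G A V : vdual V -> {ptws V -> A})).

Lemma vdual_eval_continuous V (v : V) : continuous (fun p : vdual V => p v).
Proof.
move=> p; apply: (@continuous_comp (vdual V) {ptws V -> A} A
  (@vdual_fun G A V) (fun q => q v)); last exact: ptws_eval_continuous.
exact: (@initial_continuous (vdual V) {ptws V -> A} (@vdual_fun G A V)).
Qed.

Lemma vdual_continuous V (X : topologicalType) (h : X -> vdual V) :
  (forall v, continuous (fun x => h x v)) -> continuous h.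
Proof.
move=> hc; apply: (@continuous_comp_initial (vdual V) X {ptws V -> A}
  (@vdual_fun G A V) h).
exact: ptws_continuous.
Qed.

Fact vdual_add_continuous V :
  continuous (fun p : vdual V * vdual V => p.1 + p.2).
Proof.
apply: vdual_continuous => v p.
apply: (@continuous_comp (vdual V * vdual V)%type (A * A)%type A
  (fun p => (p.1 v, p.2 v)) (fun p => p.1 + p.2)); last exact: add_continuous.
apply: cvg_pair.
  apply: (@continuous_comp _ (vdual V) A fst (fun p => p v)).
    exact: cvg_fst.
  exact: vdual_eval_continuous.
apply: (@continuous_comp _ (vdual V) A snd (fun p => p v)).
  exact: cvg_snd.
exact: vdual_eval_continuous.
Qed.
HB.instance Definition _ V :=
  PreTopologicalNmodule_isTopologicalNmodule.Build (vdual V)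
    (@vdual_add_continuous V).

Fact vdual_opp_continuous V : continuous (-%R : vdual V -> vdual V).
Proof.
apply: vdual_continuous => v p.
apply: (@continuous_comp (vdual V) A A (fun p => p v) -%R).
  exact: vdual_eval_continuous.
exact: opp_continuous.
Qed.
HB.instance Definition _ V :=
  TopologicalNmodule_isTopologicalZmodule.Build (vdual V)
    (@vdual_opp_continuous V).

Fact vdual_gact_subproof V (g : G) (p : vdual V) :
  `[< is_flinear (fun v => gact g (p v)) >].
Proof.
apply/asboolP => a u v; rewrite (vdualP p) raddfD /=.
by rewrite (ghom_gact (a : ghom A A)).
Qed.
Definition vdual_gact V (g : G) (p : vdual V) : vdual V :=
  VDual (vdual_gact_subproof g p).

Fact vdual_gact1 V (p : vdual V) : vdual_gact 1%g p = p.
Proof. by apply: vdual_ext => v; apply: gact1. Qed.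
Fact vdual_gactM V g h (p : vdual V) :
  vdual_gact (g * h)%g p = vdual_gact g (vdual_gact h p).
Proof. by apply: vdual_ext => v; apply: gactM. Qed.
Fact vdual_gactD V g (p q : vdual V) :
  vdual_gact g (p + q) = vdual_gact g p + vdual_gact g q.
Proof. by apply: vdual_ext => v; apply: gactD. Qed.
HB.instance Definition _ V := isGModule.Build G (vdual V)
  (@vdual_gact1 V) (@vdual_gactM V) (@vdual_gactD V).

Fact vdual_gact_continuous V :
  continuous (fun p : G * vdual V => gact p.1 p.2).
Proof.
apply: vdual_continuous => v p.
apply: (@continuous_comp (G * vdual V)%type (G * A)%type A
  (fun p => (p.1, p.2 v)) (fun p => gact p.1 p.2)); last first.
  exact: gact_continuous.
apply: cvg_pair; first exact: cvg_fst.
apply: (@continuous_comp (G * vdual V)%type (vdual V) A snd (fun p => p v)).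
  exact: cvg_snd.
exact: vdual_eval_continuous.
Qed.

Fact vdual_compact V : compact [set: vdual V].
Proof.
move=> F FF _.
have FT : (@vdual_fun G A V @ F) [set p | forall v : V, [set: A] (p v)].
  by apply: (@filterS _ F _ setT) => //; exact: filterT.
have [p [_ pF]] := @tychonoff V (fun=> A) (fun=> setT)
  (fun=> @pmod_compact G A) _ (fmap_proper_filter _ FF) FT.
have nbp v : nbhs (p : {ptws V -> A}) [set q : {ptws V -> A} | q v = p v].
  apply: (@ptws_eval_continuous V A v p [set p v]).
  apply: open_nbhs_nbhs; split=> //; exact: finSimpleMod_open.
have pL : is_flinear p.
  move=> a u v.
  have Fr : (@vdual_fun G A V @ F) (range (@vdual_fun G A V)).
    by apply: (@filterS _ F _ setT); [move=> r _; exists r | exact: filterT].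
  have [q [[r _ <-] [eauv [eu ev]]]] := pF _ _ Fr
    (filterI (nbp (a *: u + v)) (filterI (nbp u) (nbp v))).
  by rewrite -eauv -eu -ev; exact: vdualP.
have pL' : `[< is_flinear p >] by apply/asboolP.
exists (VDual pL'); split=> // D B FD [_ [[U oU <-]] /= Up UB].
have FD' : (@vdual_fun G A V @ F) (@vdual_fun G A V @` D).
  by apply: (@filterS _ F _ D) => // r Dr; exists r.
have [q [[r Dr <-] Ur]] := pF _ _ FD' (open_nbhs_nbhs (conj oU Up)).
by exists r; split=> //; apply: UB.
Qed.

Fact vdual_separated V (p q : vdual V) : p <> q -> exists v, p v <> q v.
Proof.
by move=> pq; apply/existsNP => e; apply: pq; apply: vdual_ext.
Qed.

Fact vdual_zero_dimensional V : zero_dimensional (vdual V).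
Proof.
move=> p q /eqP/vdual_separated[v pqv].
exists ((fun r : vdual V => r v) @^-1` [set p v]); split=> //=; last exact/nesym.
apply: preimage_clopen; last exact: vdual_eval_continuous.
split; first exact: finSimpleMod_open.
exact: finSimpleMod_closed.
Qed.

Fact vdual_hausdorff V : hausdorff_space (vdual V).
Proof.
move=> p q cpq; apply: contrapT => /vdual_separated[v]; apply.
apply: (@pmod_hausdorff G A) => U W Up Wq.
have [r [Ur Wr]] := cpq _ _ (@vdual_eval_continuous V v p U Up)
  (@vdual_eval_continuous V v q W Wq).
by exists (r v).
Qed.

HB.instance Definition _ V := isProfiniteModule.Build G (vdual V)
  (@vdual_gact_continuous V) (@vdual_compact V) (@vdual_hausdorff V)
  (zero_dimension_totally_disconnected (@vdual_zero_dimensional V)).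

Fact vdual_eval_subproof V (v : V) : `[< is_ghom (fun p : vdual V => p v) >].
Proof. by apply/asboolP; split=> //; exact: vdual_eval_continuous. Qed.
Definition vdual_eval V (v : V) : ghom (vdual V) A := GHom (vdual_eval_subproof v).

Fact vdual_map_subproof1 V1 V2 (T : {linear V2 -> V1}) (p : vdual V1) :
  `[< is_flinear (p \o T) >].
Proof. by apply/asboolP => a u v; rewrite /= linearP (vdualP p). Qed.
Definition vdual_comp V1 V2 (T : {linear V2 -> V1}) (p : vdual V1) : vdual V2 :=
  VDual (vdual_map_subproof1 T p).
Fact vdual_map_subproof V1 V2 (T : {linear V2 -> V1}) :
  `[< is_ghom (vdual_comp T) >].
Proof.
apply/asboolP; split=> [p q|g p|].
- by apply: vdual_ext.
- by apply: vdual_ext.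
- by apply: vdual_continuous => v; exact: vdual_eval_continuous.
Qed.
Definition vdual_map V1 V2 (T : {linear V2 -> V1}) : ghom (vdual V1) (vdual V2) :=
  GHom (vdual_map_subproof T).

End VDual.

(* Linear selection for total linear relations over a field; it provides the
   linear lifts needed to define functorY. *)

Section LinearSelection.
Variables (F : fieldType) (V Z : lmodType F) (R : V -> Z -> Prop).
Hypothesis R_linear : forall (a : F) u v z w,
  R u z -> R v w -> R (a *: u + v) (a *: z + w).
Hypothesis R_total : forall v, exists z, R v z.

Let R0 : R 0 0.
Proof.
by have [z Rz] := R_total 0; have := R_linear (-1) Rz Rz; rewrite !scaleN1r !addNr.
Qed.

Let graph0 (A : set (V * Z)) : set (V * Z) := A `|` [set (0, 0)].
Let P (A : set (V * Z)) :=
  [/\ forall p, graph0 A p -> R p.1 p.2,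
      forall (a : F) p q, graph0 A p -> graph0 A q ->
        graph0 A (a *: p.1 + q.1, a *: p.2 + q.2) &
      forall z, graph0 A (0, z) -> z = 0].

Lemma linear_selection : exists h : {linear V -> Z}, forall v, R v (h v).
Proof.
have chain (C : set (set (V * Z))) : C `<=` P -> total_on C subset ->
    P (\bigcup_(X in C) X).
  move=> CP Ctot; split.
  - move=> p [[X CX Xp]|->] //; case: (CP _ CX) => + _ _; apply; by left.
  - have lin1 (a : F) X p q : C X -> graph0 X p -> graph0 X q ->
        graph0 (\bigcup_(X in C) X) (a *: p.1 + q.1, a *: p.2 + q.2).
      move=> CX Xp Xq; case: (CP _ CX) => _ + _ => /(_ a _ _ Xp Xq).
      by case=> [Xpq|->]; [left; exists X|right].
    move=> a p q [[X CX Xp]|->] [[Y CY Yq]|->].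
    + case: (Ctot _ _ CX CY) => [XY|YX].
        by apply: (lin1 a Y) => //; left => //; exact: XY.
      by apply: (lin1 a X) => //; left => //; exact: YX.
    + by apply: (lin1 a X) => //; [left|right].
    + by apply: (lin1 a Y) => //; [right|left].
    + by right; rewrite /= !scaler0 !addr0.
  - move=> z [[X CX Xz]|[->]] //; case: (CP _ CX) => _ _; apply; by left.
have [A [[AR Alin Afun] Amax]] := Zorn_bigcup chain.
have A0 : graph0 A (0, 0) by right.
have Atot v0 : exists z, graph0 A (v0, z).
  apply: contrapT => nv0; have [z0 Rz0] := R_total v0.
  pose B : set (V * Z) := [set r | exists (c : F) p, graph0 A p /\
    r = (c *: v0 + p.1, c *: z0 + p.2)].
  have AB p : graph0 A p -> B p.
    by move=> Ap; exists 0, p; split=> //; rewrite !scale0r !add0r -surjective_pairing.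
  have B0 p : graph0 B p -> B p by case=> [//|->]; exact: AB.
  apply: (Amax B).
    split; first by move=> p Ap; apply: AB; left.
    move=> /(_ (v0, z0)) BA; apply: nv0; exists z0; left; apply: BA.
    by exists 1, (0, 0); split=> //; rewrite !scale1r !addr0.
  split.
  - move=> _ /B0[c [p [Ap ->]]] /=; apply: R_linear => //; exact: AR.
  - move=> a _ _ /B0[c [p [Ap ->]]] /B0[d [q [Aq ->]]]; left.
    exists (a * c + d), (a *: p.1 + q.1, a *: p.2 + q.2); split; first exact: Alin.
    have E (W : lmodType F) (x y w : W) :
        a *: (c *: x + y) + (d *: x + w) = (a * c + d) *: x + (a *: y + w).
      by rewrite scalerDr scalerA scalerDl addrACA.
    by rewrite /= !E.
  - move=> z /B0[c [p [Ap [/esym/eqP e ->]]]].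
    have [c0|c0] := eqVneq c 0.
      move: e; rewrite c0 !scale0r !add0r => /eqP p0; apply: Afun.
      by rewrite -p0 -surjective_pairing.
    case: nv0; exists (- c^-1 *: p.2).
    have -> : v0 = - c^-1 *: p.1.
      move: e; rewrite addrC addr_eq0 => /eqP ->.
      by rewrite scalerN scaleNr opprK scalerA mulVf // scale1r.
    by have := Alin (- c^-1) _ _ Ap A0; rewrite /= !addr0.
pose h v := projT1 (cid (Atot v)).
have hP v : graph0 A (v, h v) by rewrite /h; case: cid.
have hlin : linear h.
  move=> a u v; apply/eqP; rewrite eq_sym -subr_eq0; apply/eqP; apply: Afun.
  have := Alin (-1) _ _ (hP (a *: u + v)) (Alin a _ _ (hP u) (hP v)).
  by rewrite /= !scaleN1r addNr [X in (_, X)]addrC.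
pose hL : {linear V -> Z} := HB.pack h (GRing.isLinear.Build _ _ _ _ h hlin).
by exists hL => v; exact: (AR _ (hP v)).
Qed.
End LinearSelection.

Section DualCocycle.
Variables (G : profiniteGroupType) (A : finSimpleModType G).
Implicit Types (n : nat) (V : lmodType (gendo A)).

Fact cocycle_cochain_linear n :
  linear (@cocycle_cochain G n A : cocycle n A -> cochain n A).
Proof. by move=> a z w; apply: cochain_ext. Qed.
HB.instance Definition _ n := GRing.isLinear.Build (gendo A)
  (cocycle n A) (cochain n A) _ (@cocycle_cochain G n A)
  (@cocycle_cochain_linear n).

Fact coh_class_scalable n : scalable (@coh_class G n A).
Proof. by move=> a z; rewrite -[LHS](coh_mapE a z). Qed.
HB.instance Definition _ n := GRing.isScalable.Build (gendo A)
  (cocycle n A) (coh n A) _ (@coh_class G n A) (@coh_class_scalable n).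

Fact dual_value_subproof n V (S : {linear V -> cochain n A})
    (s : {ptws 'I_n -> G}) : `[< is_flinear (fun v => S v s) >].
Proof. by apply/asboolP => a u v; rewrite linearP. Qed.
Definition dual_value n V (S : {linear V -> cochain n A})
    (s : {ptws 'I_n -> G}) : vdual V := VDual (dual_value_subproof S s).

Fact dual_cochain_subproof n V (S : {linear V -> cochain n A}) :
  `[< continuous (dual_value S) >].
Proof.
by apply/asboolP; apply: vdual_continuous => v; exact: cochain_continuous.
Qed.
Definition dual_cochain n V (S : {linear V -> cochain n A}) :
  cochain n (vdual V) := Cochain (dual_cochain_subproof S).

Lemma diff_dual_cochain n V (S : {linear V -> cochain n A}) s v :
  (diff (dual_cochain S) s : vdual V) v = diff (S v) s.
Proof.
by have /= <- :=
  congr1 (fun f => f s) (diff_ghom (vdual_eval v) (dual_cochain S)).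
Qed.

Fact dual_cocycle_subproof n V (S : {linear V -> cocycle n A}) :
  `[< diff (dual_cochain (@cocycle_cochain G n A \o S)) = 0 >].
Proof.
apply/asboolP/funext => s; apply: vdual_ext => v; rewrite diff_dual_cochain.
exact: (congr1 (fun f => f s) (cocycleP (S v))).
Qed.
Definition dual_cocycle n V (S : {linear V -> cocycle n A}) :
  cocycle n (vdual V) := Cocycle (dual_cocycle_subproof S).

Lemma dual_cocycle_indep n V (S1 S2 : {linear V -> cocycle n A}) :
  (forall v, coh_class (S1 v) = coh_class (S2 v)) ->
  coh_class (dual_cocycle S1) = coh_class (dual_cocycle S2).
Proof.
move=> S12; apply/coh_class_eq.
have {S12} : forall v, is_coboundary (S1 v - S2 v : cocycle n A).
  by move=> v; apply/coh_class_eq.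
case: n S1 S2 => [|n] S1 S2 /= S12.
  by apply/funext => s; apply: vdual_ext => v; exact: (congr1 (fun f => f s) (S12 v)).
have [|h hP] := linear_selection _ S12.
  move=> a u v z w /= uz vw; rewrite !linearP.
  have -> : diff (a *: z + w : cochain n A) = (a \o diff z) + diff w.
    by rewrite -diff_ghom -raddfD.
  rewrite -uz -vw; apply/funext => s.
  by rewrite !fctE /= raddfB opprD addrACA.
exists (dual_cochain h); apply/funext => s; apply: vdual_ext => v.
by rewrite diff_dual_cochain -hP.
Qed.

Lemma linear_lift_ex n V (S : {linear V -> coh n A}) :
  exists S' : {linear V -> cocycle n A}, forall v, coh_class (S' v) = S v.
Proof.
apply: (linear_selection (R := fun v z => coh_class z = S v)).
  by move=> a u v z w uz vw; rewrite !linearP /= uz vw.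
by move=> v; exact: coh_surj.
Qed.

(* An arbitrary choice; by dual_cocycle_indep it does not matter below. *)
Definition linear_lift n V (S : {linear V -> coh n A}) :
  {linear V -> cocycle n A} := projT1 (cid (linear_lift_ex S)).

Lemma linear_liftP n V (S : {linear V -> coh n A}) v :
  coh_class (linear_lift S v) = S v.
Proof. by rewrite /linear_lift; case: cid. Qed.

End DualCocycle.

Record category := Category {
  obj :> Type;
  hom : obj -> obj -> Type;
  idm : forall a, hom a a;
  compm : forall a b c, hom b c -> hom a b -> hom a c;
  compm_idl : forall a b (f : hom a b), compm (idm b) f = f;
  compm_idr : forall a b (f : hom a b), compm f (idm a) = f;
  compmA : forall a b c d (f : hom c d) (g : hom b c) (h : hom a b),
    compm f (compm g h) = compm (compm f g) h }.
Arguments hom {c} a b : rename.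
Arguments idm {c} a : rename.
Arguments compm {c a b c0} f g : rename.

Record functor (C D : category) := Functor {
  fobj :> C -> D;
  fmap : forall a b : C, hom a b -> hom (fobj a) (fobj b);
  fmap_id : forall a : C, fmap (idm a) = idm (fobj a);
  fmap_comp : forall (a b c : C) (f : hom b c) (g : hom a b),
    fmap (compm f g) = compm (fmap f) (fmap g) }.
Arguments fmap {C D} f {a b} _ : rename.

Definition functor_id (C : category) : functor C C.
Proof. by exists (fun a => a) (fun a b f => f). Defined.

Definition functor_comp (C D E : category) (Y : functor D E) (X : functor C D) :
  functor C E.
Proof.
exists (fun a => Y (X a)) (fun a b f => fmap Y (fmap X f)).
- by move=> a; rewrite !fmap_id.
- by move=> a b c f g; rewrite !fmap_comp.
Defined.

Definition is_iso (C : category) (a b : C) (f : hom a b) :=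
  exists g : hom b a, compm g f = idm a /\ compm f g = idm b.

Definition naturally_isomorphic (C D : category) (X Y : functor C D) :=
  exists eta : forall a, hom (X a) (Y a),
    (forall a b (f : hom a b), compm (eta b) (fmap X f) = compm (fmap Y f) (eta a))
    /\ (forall a, is_iso (eta a)).

Definition quasi_inverse (C D : category) (X : functor C D) (Y : functor D C) :=
  naturally_isomorphic (functor_comp Y X) (functor_id C) /\
  naturally_isomorphic (functor_comp X Y) (functor_id D).

Definition generated_by (G : profiniteGroupType) (A : finSimpleModType G)
    (K : profiniteModType G) :=
  \bigcap_(phi in [set: ghom K A]) [set x | phi x = 0] = [set 0].

Section HT.
Variables (G : profiniteGroupType) (A : finSimpleModType G) (n : nat).

Record Hobj := HObj {
  hmod : profiniteModType G;
  hgen : generated_by A hmod;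
  hcls : coh n hmod }.

Definition Hhom (k1 k2 : Hobj) : Type :=
  {b : ghom (hmod k1) (hmod k2) | coh_map b (hcls k1) = hcls k2}.

Record Tobj := TObj {
  tspace : lmodType (gendo A);
  tmap : {linear tspace -> coh n A} }.

(* Morphisms v1 -> v2 are linear maps in the opposite direction. *)
Definition Thom (v1 v2 : Tobj) : Type :=
  {T : {linear tspace v2 -> tspace v1} | tmap v2 =1 tmap v1 \o T}.

Lemma Hhom_ext k1 k2 (b c : Hhom k1 k2) : sval b =1 sval c -> b = c.
Proof. by move=> bc; apply: eq_sig_hprop => //; exact: ghom_ext. Qed.

Lemma linear_ext (V W : lmodType (gendo A)) (f g : {linear V -> W}) :
  f =1 g -> f = g.
Proof.
move=> /funext; case: f g => f cf [g cg] /= fg.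
move: cg; rewrite -{g}fg => cg; congr GRing.Linear.Pack.
case: cf cg => [[a1] [a2]] [[b1] [b2]].
by rewrite (Prop_irrelevance a1 b1) (Prop_irrelevance a2 b2).
Qed.

Lemma Thom_ext v1 v2 (b c : Thom v1 v2) : sval b =1 sval c -> b = c.
Proof. by move=> bc; apply: eq_sig_hprop => //; exact: linear_ext. Qed.

Definition Hid k : Hhom k k := exist _ (ghom_id (hmod k)) (coh_map_id (hcls k)).

Fact Hcomp_subproof k1 k2 k3 (b : Hhom k2 k3) (c : Hhom k1 k2) :
  coh_map (ghom_comp (sval b) (sval c)) (hcls k1) = hcls k3.
Proof. by rewrite coh_map_comp (svalP c) (svalP b). Qed.
Definition Hcomp k1 k2 k3 (b : Hhom k2 k3) (c : Hhom k1 k2) : Hhom k1 k3 :=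
  exist _ (ghom_comp (sval b) (sval c)) (Hcomp_subproof b c).

Definition Hcat : category.
Proof.
by exists Hobj Hhom Hid Hcomp => *; apply: Hhom_ext.
Defined.

Definition Tid v : Thom v v := exist _ (idfun : {linear _ -> _}) (frefl _).

Fact Tcomp_subproof v1 v2 v3 (b : Thom v2 v3) (c : Thom v1 v2) :
  tmap v3 =1 tmap v1 \o (sval c \o sval b).
Proof. by move=> x; rewrite (svalP b) /= (svalP c). Qed.
Definition Tcomp v1 v2 v3 (b : Thom v2 v3) (c : Thom v1 v2) : Thom v1 v3 :=
  exist _ (sval c \o sval b : {linear _ -> _}) (Tcomp_subproof b c).

Definition Tcat : category.
Proof.
by exists Tobj Thom Tid Tcomp => *; apply: Thom_ext.
Defined.

Definition coh_eval (K : profiniteModType G) (f : coh n K) (phi : ghom K A) :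
  coh n A := coh_map phi f.
Fact coh_eval_linear K (f : coh n K) : linear (coh_eval f).
Proof.
move=> a phi psi; rewrite /coh_eval coh_mapDl; congr (_ + _).
exact: (coh_map_comp (a : ghom A A)).
Qed.
HB.instance Definition _ K (f : coh n K) :=
  GRing.isLinear.Build (gendo A) (ghom K A) (coh n A) _ (coh_eval f)
    (coh_eval_linear f).

Definition Xobj (k : Hobj) : Tobj := @TObj (ghom (hmod k) A) (coh_eval (hcls k)).

Definition ghom_precomp (K1 K2 : profiniteModType G) (b : ghom K1 K2)
  (psi : ghom K2 A) : ghom K1 A := ghom_comp psi b.
Fact ghom_precomp_linear K1 K2 (b : ghom K1 K2) : linear (ghom_precomp b).
Proof. by move=> a phi psi; apply: ghom_ext. Qed.
HB.instance Definition _ K1 K2 (b : ghom K1 K2) :=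
  GRing.isLinear.Build (gendo A) (ghom K2 A) (ghom K1 A) _ (ghom_precomp b)
    (ghom_precomp_linear b).

Fact Xmap_subproof k1 k2 (b : Hhom k1 k2) :
  tmap (Xobj k2) =1 tmap (Xobj k1) \o ghom_precomp (sval b).
Proof. by move=> psi /=; rewrite /coh_eval coh_map_comp (svalP b). Qed.
Definition Xmap k1 k2 (b : Hhom k1 k2) : Thom (Xobj k1) (Xobj k2) :=
  exist _ (ghom_precomp (sval b) : {linear _ -> _}) (Xmap_subproof b).

Definition functorX : functor Hcat Tcat.
Proof.
by exists (Xobj : Hcat -> Tcat) Xmap => *; apply: Thom_ext => psi; apply: ghom_ext.
Defined.

Fact vdual_generated (V : lmodType (gendo A)) : generated_by A (vdual V).
Proof.
apply/seteqP; split=> [p pK|_ -> phi _ /=]; last exact: raddf0.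
by apply: vdual_ext => v; exact: (pK (vdual_eval v) I).
Qed.

Definition Yobj (v : Tobj) : Hobj :=
  HObj (@vdual_generated (tspace v))
    (coh_class (dual_cocycle (linear_lift (tmap v)))).

Lemma Yobj_indep (v : Tobj) (S' : {linear tspace v -> cocycle n A}) :
  (forall x, coh_class (S' x) = tmap v x) ->
  hcls (Yobj v) = coh_class (dual_cocycle S').
Proof.
by move=> S'P; apply: dual_cocycle_indep => x; rewrite linear_liftP S'P.
Qed.

Fact Ymap_subproof v1 v2 (T : Thom v1 v2) :
  coh_map (vdual_map (sval T)) (hcls (Yobj v1)) = hcls (Yobj v2).
Proof.
rewrite /= coh_mapE; apply: etrans (esym (@Yobj_indep v2
  (linear_lift (tmap v1) \o sval T) _)).
  by congr coh_class; apply: cocycle_ext => s; apply: vdual_ext.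
by move=> x; rewrite /= linear_liftP (svalP T).
Qed.
Definition Ymap v1 v2 (T : Thom v1 v2) : Hhom (Yobj v1) (Yobj v2) :=
  exist _ (vdual_map (sval T)) (Ymap_subproof T).

Definition functorY : functor Tcat Hcat.
Proof.
by exists (Yobj : Tcat -> Hcat) Ymap => *; apply: Hhom_ext => p; apply: vdual_ext.
Defined.

End HT.

(* Main.v *)
From HB Require Import structures.
From mathcomp Require Import all_boot all_order all_algebra.
From mathcomp Require Import finmap.
From mathcomp Require Import all_classical.
From mathcomp Require Import topology.
Require Import Defs.

(** The equivalence is the cohomological form of a duality between
    A-generated profinite G-modules and vector spaces over the finite field
    F = End_G(A), with K |-> K^* = Hom_G(K, A) in one direction and
    V |-> V^* = Hom_F(V, A) in the other. The two natural isomorphisms are the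
    evaluation maps K -> K^** and V -> V^**.

    What makes the duality work is the simplicity of A. If a homomorphism
    phi : K -> A vanishes on the common kernel of psi_1, .., psi_m, then phi is
    an F-combination of the psi_i ([common_ker_span]): on the common kernel of
    all the psi_i but one, the remaining one is zero or onto, and when it is
    onto, phi factors there through it by an endomorphism of A. The rest is
    finite approximation followed by compactness.

    - For K: given p in K^**, the span lemma shows that finitely many of the
      equations psi x = p psi can be solved at once ([vdual_interpolation]), and
      compactness of K solves all of them, so K -> K^** is onto. It is injective
      exactly when K is A-generated, and a continuous bijection between compact
      Hausdorff spaces has a continuous inverse.

    - For V: a continuous phi : V^* -> A has an open kernel, so by compactness
      of V^* it vanishes on the common kernel of finitely many evaluations; the
      span lemma makes it a combination of evaluations, hence itself an
      evaluation. Injectivity of V -> V^** says that linear functionals separate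
      the points of V, which needs the axiom of choice.

    The cohomology classes follow along. If z is a cocycle representing f in
    H^n(G, K), then phi |-> phi o z is a linear lift of S_(K, f), and the cocycle
    that it defines with values in K^** is z followed by evaluation. Conversely,
    evaluating at v the cocycle built from a lift S' of S gives back S' v. *)

Set Implicit Arguments.
Unset Strict Implicit.
Unset Printing Implicit Defensive.

Import GRing.Theory.

Local Open Scope classical_set_scope.
Local Open Scope ring_scope.

(** * Compactness *)

(** The finite intersection property for a family indexed by any choice type.
    Indexing by lists lets the finite subfamilies be treated by induction. *)
Lemma compact_bigcap_seq (T : topologicalType) (I : choiceType)
    (C : I -> set T) :
    compact [set: T] -> (forall i, closed (C i)) ->
    (forall s : seq I, exists x, forall i, i \in s -> C i x) ->
  exists x, forall i, C i x.
Proof.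
move=> Tc Cc fip; have [x0 _] := fip [::].
pose pT : ptopologicalType := HB.pack (T : Type) T (isPointed.Build T x0).
have : @compact pT [set: pT] by [].
rewrite compact_In0 => /(_ I setT C)[||x xC].
- by exists C => [i _|i _]; [exact: Cc|rewrite setTI].
- by move=> D _; have [x xD] := fip (enum_fset D); exists x => i; exact: xD.
- by exists x => i; exact: xC.
Qed.

Lemma compact_inverse_continuous (X Y : topologicalType) (f : X -> Y)
    (g : Y -> X) :
    compact [set: X] -> hausdorff_space Y -> continuous f ->
    cancel f g -> cancel g f ->
  continuous g.
Proof.
move=> Xc Yh fc fK gK; apply/continuous_closedP => C Cc.
have -> : g @^-1` C = f @` C.
  apply/seteqP; split=> [y gy|_ [x Cx <-]]; last by rewrite /= fK.
  by exists (g y) => //; rewrite gK.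
apply: (compact_closed Yh); apply: continuous_compact.
  exact: continuous_subspaceT.
exact: subclosed_compact Cc Xc _.
Qed.

(** * Homomorphisms into a simple module *)

Section Span.
Variables (G : profiniteGroupType) (A : finSimpleModType G).
Variable K : profiniteModType G.

Lemma ghom_preimage_closed (phi : ghom K A) (B : set A) : closed (phi @^-1` B).
Proof.
apply: (continuous_closedP phi).1; first exact: ghom_continuous.
exact: finSimpleMod_closed.
Qed.

Definition common_ker (s : seq (ghom K A)) : set K :=
  [set x | forall psi, psi \in s -> psi x = 0].

Lemma common_ker_gsubmodule s : gsubmodule (common_ker s).
Proof.
split=> [psi _|x y x0 y0 psi ps|g x x0 psi ps]; first by rewrite raddf0.
  by rewrite raddfB /= x0 // y0 // subr0.
by rewrite ghom_gact x0 // raddf0.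
Qed.

(** The image of a submodule under phi is a submodule of the simple module A. *)
Lemma ghom_simple_image (phi : ghom K A) (N : set K) : gsubmodule N ->
  (forall x, N x -> phi x = 0) \/ (forall a, exists2 x, N x & phi x = a).
Proof.
move=> [N0 NB Ng]; have [|e|e] := @fsmod_simple _ A (phi @` N).
- split=> [|_ _ [x Nx <-] [y Ny <-]|g _ [x Nx <-]].
  + by exists 0; rewrite ?raddf0.
  + by exists (x - y); [exact: NB|rewrite raddfB].
  + by exists (gact g x); [exact: Ng|rewrite ghom_gact].
- left=> x Nx; have : (phi @` N) (phi x) by exists x.
  by rewrite e.
- right=> a; have : [set: A] a by [].
  by rewrite -e.
Qed.

(** The values of phi on N depend only on those of psi, so lifting an element of
    A along psi and then applying phi is well defined; whatever lift is chosen,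
    the result is G-linear. *)
Lemma ghom_factor (phi psi : ghom K A) (N : set K) : gsubmodule N ->
    (forall a, exists2 x, N x & psi x = a) ->
    (forall x, N x -> psi x = 0 -> phi x = 0) ->
  exists alpha : gendo A, forall x, N x -> phi x = alpha (psi x).
Proof.
move=> [N0 NB Ng] psiN phiN.
have lift_ex a : exists x, N x /\ psi x = a by have [x] := psiN a; exists x.
pose lift a := projT1 (cid (lift_ex a)).
have [liftN liftK] : (forall a, N (lift a)) /\ (forall a, psi (lift a) = a).
  by split=> a; rewrite /lift; case: cid => x [].
have phiE x y : N x -> N y -> psi x = psi y -> phi x = phi y.
  move=> Nx Ny xy; apply/eqP; rewrite -subr_eq0 -raddfB; apply/eqP.
  by apply: phiN; [exact: NB|rewrite raddfB /= xy subrr].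
have ND x y : N x -> N y -> N (x + y).
  by move=> Nx Ny; rewrite -[y]opprK -[- y]sub0r; exact: NB Nx (NB _ _ N0 Ny).
have aG : `[< is_ghom (phi \o lift) >].
  apply/asboolP; split=> [a b|g a|]; last exact: finSimpleMod_continuous.
  - rewrite /= -raddfD; apply: phiE => //; first exact: ND.
    by rewrite raddfD /= !liftK.
  - rewrite /= -ghom_gact; apply: phiE => //; first exact: Ng.
    by rewrite ghom_gact !liftK.
by exists (GHom aG : gendo A) => x Nx /=; apply: phiE => //; rewrite liftK.
Qed.

(** The linear span of [s] is replaced by any subspace [W] containing [s], so
    that no linear combinations over lists have to be handled. In the induction
    step, [psi] maps the common kernel N of the tail onto 0 or onto A. In the
    first case it puts no condition on N. In the second, phi agrees on N with
    some [alpha *: psi], and the induction hypothesis applies to the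
    difference. *)
Lemma common_ker_span (W : set (ghom K A)) (s : seq (ghom K A)) :
    W 0 ->
    (forall (a : gendo A) phi psi, W phi -> W psi -> W (a *: phi + psi)) ->
    (forall psi, psi \in s -> W psi) ->
  forall phi : ghom K A, (forall x, common_ker s x -> phi x = 0) -> W phi.
Proof.
move=> W0 Wlin; elim: s => [|psi s IHs] sW phi phi0.
  by have -> : phi = 0 by apply: ghom_ext => x; apply: phi0.
have {}IHs := IHs (fun chi cs => sW chi (@mem_behead _ (psi :: s) chi cs)).
have kerS x : common_ker s x -> psi x = 0 -> common_ker (psi :: s) x.
  by move=> xs px chi; rewrite inE => /predU1P[->//|]; exact: xs.
have sG := common_ker_gsubmodule s.
have [psi0|psiT] := ghom_simple_image psi sG.
  by apply: IHs => x xs; apply: phi0; apply: kerS => //; exact: psi0.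
have [|alpha alphaE] := ghom_factor (phi := phi) sG psiT.
  by move=> x xs px; apply: phi0; exact: kerS.
have -> : phi = alpha *: psi + (phi - alpha *: psi) by rewrite addrC subrK.
apply: Wlin; first by apply: sW; rewrite mem_head.
apply: IHs => x xs; rewrite -[LHS]/(phi x - alpha (psi x)).
by rewrite alphaE // subrr.
Qed.

(** This is the density of the image of K in K^**. To add [psi], either [psi]
    is onto on the common kernel of [s] and a solution for [s] can be corrected
    by an element of that kernel, or [psi] is in the span of [s] and its
    equation follows from the others. *)
Lemma vdual_interpolation (p : vdual (ghom K A)) (s : seq (ghom K A)) :
  exists x : K, forall psi : ghom K A, psi \in s -> psi x = p psi.
Proof.
elim: s => [|psi s [x xs]]; first by exists 0.
have sG := common_ker_gsubmodule s.
have [psi0|psiT] := ghom_simple_image psi sG.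
  exists x => chi; rewrite inE => /predU1P[->|]; last exact: xs.
  (* The homomorphisms on which evaluation at x agrees with p form a subspace. *)
  apply: (common_ker_span (W := [set phi : ghom K A | phi x = p phi])
    _ _ xs psi0) => /=.
  - have := vdualP p (-1) 0 0; rewrite scaler0 addr0 /= => ->.
    by rewrite addNr.
  - by move=> a f g fx gx; rewrite vdualP -fx -gx.
have [y ys ypsi] := psiT (p psi - psi x).
exists (y + x) => chi; rewrite inE raddfD /=.
by case/predU1P=> [->|cs]; [rewrite ypsi subrK|rewrite ys // add0r xs].
Qed.

End Span.

(** * Biduality for vector spaces *)

Section Separation.
Variables (F : fieldType) (V : lmodType F).

(** Zorn's lemma gives a maximal subspace [W] avoiding [v]. By maximality every
    vector is congruent modulo [W] to a multiple of [v], and the coefficient of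
    that multiple is the functional. *)
Lemma linear_functional_eq1 (v : V) : v != 0 ->
  exists h : {linear V -> F^o}, h v = 1.
Proof.
move=> v0.
pose P (W : set V) :=
  (forall (a : F) x y, W x -> W y -> W (a *: x + y)) /\ ~ W v.
have chain (C : set (set V)) : C `<=` P -> total_on C subset ->
    P (\bigcup_(X in C) X).
  move=> CP Ctot; split=> [a x y [X CX Xx] [Y CY Yy]|[X CX Xv]]; last first.
    by case: (CP _ CX).
  case: (Ctot _ _ CX CY) => [XY|YX].
    by exists Y => //; have [+ _] := CP _ CY; apply=> //; exact: XY.
  by exists X => //; have [+ _] := CP _ CX; apply=> //; exact: YX.
have [W [[Wlin Wv] Wmax]] := Zorn_bigcup chain.
(* P also holds for the empty set, which makes it stable under the union of an
   empty chain; maximality excludes it. *)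
have W0 : W 0.
  apply: contrapT => nW0; apply: (Wmax (W `|` [set 0])).
    by split=> [x|/(_ 0 (or_intror erefl))//]; left.
  split=> [a x y Wx Wy|[//|/= /eqP]]; last by rewrite (negPf v0).
  have nW z : ~ W z.
    by move=> Wz; apply: nW0; rewrite -(addNr z) -scaleN1r; exact: Wlin.
  by right; case: Wx Wy => [/nW//|->] [/nW//|->]; rewrite /= scaler0 addr0.
have Wscale c x : W x -> W (c *: x).
  by move=> Wx; rewrite -[_ *: _]addr0; exact: Wlin.
have Wv_eq0 c : W (c *: v) -> c = 0.
  move=> Wcv; apply/eqP; apply: contra_notT Wv => c0.
  by rewrite -[v]scale1r -(mulVf c0) -scalerA; exact: Wscale.
pose R (u : V) (c : F^o) := W (u - c *: v).
have Rlin (a : F) u w z t : R u z -> R w t -> R (a *: u + w) (a *: z + t).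
  rewrite /R => uz wt; have := Wlin a _ _ uz wt.
  by rewrite scalerBr scalerA addrACA -opprD -scalerDl.
have Rtot u : exists c, R u c.
  have [Wu|nWu] := pselect (W u); first by exists 0; rewrite /R scale0r subr0.
  (* W' is the sum of W and the line of u, so it contains v. *)
  pose W' : set V := [set x | exists c w, W w /\ x = c *: u + w].
  have [c [w [Ww e]]] : W' v.
    apply: contrapT => W'v; apply: (Wmax W').
      split=> [x Wx|W'W]; first by exists 0, x; rewrite scale0r add0r.
      by apply: nWu; apply: W'W; exists 1, 0; rewrite scale1r addr0.
    split=> // a _ _ [c [w [Ww ->]]] [d [t [Wt ->]]].
    exists (a * c + d), (a *: w + t); split; first exact: Wlin.
    by rewrite scalerDr scalerA addrACA -scalerDl.
  have [c0|c0] := eqVneq c 0; first by move: Wv; rewrite e c0 scale0r add0r.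
  exists c^-1; rewrite /R e scalerDr scalerA mulVf // scale1r opprD addrA.
  by rewrite subrr add0r -scaleNr; exact: Wscale.
have [h hR] := linear_selection Rlin Rtot.
exists h; have := hR v; rewrite /R -{1}[v]scale1r -scalerBl => /Wv_eq0/eqP.
by rewrite subr_eq0 => /eqP <-.
Qed.

End Separation.

Section VdualBidual.
Variables (G : profiniteGroupType) (A : finSimpleModType G).
Variable V : lmodType (gendo A).

Lemma vdual_separates (v : V) : (forall p : vdual V, p v = 0) -> v = 0.
Proof.
move=> pv0; apply/eqP/negPn/negP => v0.
(* A functional h with h v = 1 composed with the orbit map c |-> c a takes the
   value a at v, so every a in A would be 0. *)
have [h hv] := linear_functional_eq1 v0.
apply: (@fsmod_nonzero _ A); apply/seteqP; split=> // a _.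
have pL : `[< is_flinear (fun u => (h u : gendo A) a) >].
  by apply/asboolP => c u w; rewrite linearP.
by have := pv0 (VDual pL); rewrite /= hv.
Qed.

Fact vdual_eval_linear : linear (@vdual_eval G A V : V -> ghom (vdual V) A).
Proof. by move=> a u v; apply: ghom_ext => p; exact: vdualP. Qed.
HB.instance Definition _ := GRing.isLinear.Build (gendo A) V (ghom (vdual V) A)
  _ (@vdual_eval G A V) vdual_eval_linear.

Lemma vdual_eval_inj : injective (@vdual_eval G A V).
Proof.
apply: raddf_inj => v v0; apply: vdual_separates => p.
exact: (congr1 (fun f : ghom _ A => f p) v0).
Qed.

(** If no finite set of evaluations controlled [phi], then by compactness some
    p in V^* would have [phi p <> 0] although all its values are 0. So [phi]
    vanishes on a finite common kernel of evaluations, and the evaluations form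
    a subspace. *)
Lemma vdual_eval_surj (phi : ghom (vdual V) A) : exists v, vdual_eval v = phi.
Proof.
have [s sP] : exists s : seq V, forall p : vdual V,
    (forall v, v \in s -> p v = 0) -> phi p = 0.
  apply: contrapT => /forallNP nP.
  pose C v : set (vdual V) := [set p : vdual V | p v = 0 /\ phi p <> 0].
  have [v|s|p pC] := compact_bigcap_seq (C := C) (@pmod_compact G _).
  - apply: closedI; first exact: ghom_preimage_closed (vdual_eval v) [set 0].
    exact: ghom_preimage_closed phi (~` [set 0]).
  - have /existsNP[p /not_implyP[ps phip]] := nP s.
    by exists p => v vs; split=> //; exact: ps.
  (* The point p found by compactness is 0, but phi does not vanish there. *)
  - have [_] := pC 0; apply.
    have -> : p = 0 by apply: vdual_ext => v; case: (pC v).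
    exact: raddf0.
suff [v _ <-] : range (@vdual_eval G A V) phi by exists v.
apply: (common_ker_span (s := map (@vdual_eval G A V) s))
  => [||psi /mapP[v _ ->]|p ps].
- by exists 0; rewrite ?raddf0.
- by move=> a _ _ [u _ <-] [v _ <-]; exists (a *: u + v); rewrite ?linearP.
- by exists v.
- by apply: sP => v vs; exact: (ps (vdual_eval v) (map_f _ vs)).
Qed.

End VdualBidual.

(** * Biduality for profinite modules *)

Section ModuleBidual.
Variables (G : profiniteGroupType) (A : finSimpleModType G).
Variable K : profiniteModType G.

Fact bidual_eval_subproof (x : K) :
  `[< is_flinear (fun phi : ghom K A => phi x) >].
Proof. by apply/asboolP. Qed.
Definition bidual_eval (x : K) : vdual (ghom K A) :=
  VDual (bidual_eval_subproof x).

Fact bidual_map_subproof : `[< is_ghom bidual_eval >].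
Proof.
apply/asboolP; split=> [x y|g x|].
- by apply: vdual_ext => phi; exact: raddfD.
- by apply: vdual_ext => phi; exact: ghom_gact.
- by apply: vdual_continuous => phi; exact: ghom_continuous.
Qed.
Definition bidual_map : ghom K (vdual (ghom K A)) := GHom bidual_map_subproof.

Lemma bidual_map_inj : generated_by A K -> injective bidual_map.
Proof.
move=> Kgen; apply: raddf_inj => x x0.
have : (\bigcap_(phi in [set: ghom K A]) [set x | phi x = 0]) x.
  by move=> phi _ /=; exact: (congr1 (fun q : vdual _ => q phi) x0).
by rewrite Kgen.
Qed.

Lemma bidual_map_surj (p : vdual (ghom K A)) : exists x, bidual_map x = p.
Proof.
have [||x xC] := compact_bigcap_seq
  (C := fun phi : ghom K A => [set x : K | phi x = p phi]) (@pmod_compact G K).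
- by move=> phi; exact: ghom_preimage_closed phi [set p phi].
- exact: vdual_interpolation.
- by exists x; exact: vdual_ext.
Qed.

End ModuleBidual.

Lemma bijective_ghom_inverse (G : profiniteGroupType) (K1 K2 : profiniteModType G)
    (f : ghom K1 K2) :
    injective f -> (forall y, exists x, f x = y) ->
  exists g : ghom K2 K1, cancel f g /\ cancel g f.
Proof.
move=> fi fs; pose g y := projT1 (cid (fs y)).
have gK : cancel g f by move=> y; rewrite /g; case: cid.
have fK : cancel f g by move=> x; apply: fi; rewrite gK.
have gG : `[< is_ghom g >].
  apply/asboolP; split=> [x y|h x|].
  - by apply: fi; rewrite raddfD /= !gK.
  - by apply: fi; rewrite ghom_gact !gK.
  - exact: compact_inverse_continuous (@pmod_compact G K1) (@pmod_hausdorff G K2)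
      (@ghom_continuous _ _ _ f) fK gK.
by exists (GHom gG).
Qed.

(** * The equivalence of categories *)

Lemma naturally_isomorphic_sym (C D : category) (X Y : functor C D) :
  naturally_isomorphic X Y -> naturally_isomorphic Y X.
Proof.
move=> [eta [etaN etaI]]; pose eps a := projT1 (cid (etaI a)).
have epsK a : compm (eps a) (eta a) = idm (X a) /\
    compm (eta a) (eps a) = idm (Y a) by rewrite /eps; case: cid.
exists eps; split=> [a b f|a]; last by exists (eta a); case: (epsK a).
have [eta_eps _] := epsK b; have [_ eps_eta] := epsK a.
rewrite -[fmap Y f]compm_idr -eps_eta (compmA (fmap Y f)) -etaN.
by rewrite !compmA eta_eps compm_idl.
Qed.

Section Equivalence.
Variables (G : profiniteGroupType) (A : finSimpleModType G) (n : nat).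

Fact eval_cocycle_linear (K : profiniteModType G) (z : cocycle n K) :
  linear (fun phi : ghom K A => cocycle_map phi z : cocycle n A).
Proof. by move=> a phi psi; exact: cocycle_ext. Qed.

(** The class that Y attaches to [Xobj k] may be computed from any linear lift;
    a cocycle z representing the class of [k] provides the lift
    phi |-> phi o z, whose dual cocycle is z followed by evaluation. *)
Lemma coh_map_bidual (k : Hobj A n) :
  coh_map (bidual_map A (hmod k)) (hcls k) = hcls (Yobj (Xobj k)).
Proof.
have [z zk] := coh_surj (hcls k).
pose S : {linear ghom (hmod k) A -> cocycle n A} :=
  HB.pack (fun phi : ghom (hmod k) A => cocycle_map phi z : cocycle n A)
    (GRing.isLinear.Build _ _ _ _ _ (eval_cocycle_linear z)).
rewrite (@Yobj_indep G A n (Xobj k) S) => [|phi]; last first.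
  by rewrite /= /coh_eval -zk coh_mapE.
rewrite -zk coh_mapE; congr coh_class.
by apply: cocycle_ext => s; exact: vdual_ext.
Qed.

(** The component at [k] of the transformation from the identity to YX; it is
    the inverse of this family that goes from YX to the identity. *)
Definition H_unit (k : Hobj A n) : Hhom k (Yobj (Xobj k)) :=
  exist _ (bidual_map A (hmod k)) (coh_map_bidual k).

Lemma H_unit_iso (k : Hcat A n) :
  @is_iso (Hcat A n) k (Yobj (Xobj k)) (H_unit k).
Proof.
have [g [fK gK]] := bijective_ghom_inverse
  (bidual_map_inj (@hgen _ _ _ k)) (@bidual_map_surj _ A (hmod k)).
have gH : coh_map g (hcls (Yobj (Xobj k))) = hcls k.
  rewrite -coh_map_bidual -coh_map_comp -[RHS]coh_map_id.
  by congr coh_map; exact: ghom_ext.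
by exists (exist _ g gH : Hhom (Yobj (Xobj k)) k); split; exact: Hhom_ext.
Qed.

Lemma tmap_vdual_eval (v : Tobj A n) :
  tmap v =1 tmap (Xobj (Yobj v)) \o @vdual_eval G A (tspace v).
Proof.
move=> x; rewrite /= /coh_eval coh_mapE -[LHS]linear_liftP; congr coh_class.
exact: cocycle_ext.
Qed.

(** Morphisms of T reverse the underlying linear maps, so evaluation, from V to
    its bidual, is a morphism from XY to the identity. *)
Definition T_counit (v : Tobj A n) : Thom (Xobj (Yobj v)) v :=
  exist _ (@vdual_eval G A (tspace v) : {linear _ -> _})
    (@tmap_vdual_eval v).

Lemma T_counit_iso (v : Tcat A n) :
  @is_iso (Tcat A n) (Xobj (Yobj v)) v (T_counit v).
Proof.
pose V := tspace v; pose W := tspace (Xobj (Yobj v)).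
pose f : {linear V -> W} := @vdual_eval G A V.
pose g (phi : W) : V := projT1 (cid (vdual_eval_surj phi)).
have gK : cancel g f by move=> phi; rewrite /g; case: cid.
have fK : cancel f g by move=> x; apply: vdual_eval_inj; exact: gK.
have gL : linear g.
  by move=> a phi psi; apply: vdual_eval_inj; rewrite linearP !gK.
pose gl : {linear W -> V} :=
  HB.pack g (GRing.isLinear.Build _ _ _ _ g gL).
have gT : tmap (Xobj (Yobj v)) =1 tmap v \o gl.
  by move=> phi; rewrite /= tmap_vdual_eval /= (gK phi).
by exists (exist _ gl gT : Thom v (Xobj (Yobj v))); split; exact: Thom_ext.
Qed.

End Equivalence.

Theorem proposition5p8 (G : profiniteGroupType) (A : finSimpleModType G)
    (n : nat) :
  quasi_inverse (functorX A n) (functorY A n).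
Proof.
split.
  apply: naturally_isomorphic_sym; exists (@H_unit G A n); split.
    by move=> k1 k2 b; apply: Hhom_ext => x; exact: vdual_ext.
  exact: H_unit_iso.
exists (@T_counit G A n); split; last exact: T_counit_iso.
by move=> v1 v2 T; apply: Thom_ext => x; exact: ghom_ext.
Qed.
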